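(* Let $\pi_s$ be the Poisson bivector dual to the Fubini–Study form on $\mathbb{CP}^n$, $\pi_\infty$ the Bruhat Poisson structure on $\mathbb{CP}^n$, $x_1,\dots,x_n$ the momentum map coordinates, and $c_k=x_1+\cdots+x_k$ for $1\le k\le n$. The Lenard scheme associated to the Poisson pencil $(\pi_\infty,\pi_s)$ which starts with $g_1=c_1+\cdots+c_n$ and the vector field $$V=\sum_{j=1}^n\big[(n-j+1)(x_1+\cdots+x_j)+(n-j)x_{j+1}+\cdots+2x_{n-1}+x_n\big]\partial_{\phi_j}$$ yields $$g_k=c_1^k+c_2^k+\cdots+c_n^k,$$ which determines a completely integrable bi-hamiltonian system on $\mathbb{CP}^n$.
   Context: Let $[Z_0:\cdots:Z_n]$ be homogeneous coordinates on $\mathbb{CP}^n$, and on $\{Z_0\ne0\}$ put $z_i=Z_i/Z_0=r_ie^{\sqrt{-1}\phi_i}$. The (shifted) momentum map coordinates are $$x_i=\delta_{1,i}-\frac{r_i^2}{1+r_1^2+\cdots+r_n^2},\qquad 1\le i\le n.$$ In the coordinates $(x_i,\phi_i)$ the Fubini–Study form is $\omega=\sum_{i=1}^n dx_i\wedge d\phi_i$, and $\pi_s$ is its dual bivector field. The Bruhat Poisson structure $\pi_\infty$ on $\mathbb{CP}^n$ is the smooth Poisson structure whose restriction to the largest Bruhat cell $\{Z_0\ne0\}$ is $$\pi_\infty=\sqrt{-1}\sum_{i=1}^n(1+|y_i|^2)\,\partial_{y_i}\wedge\partial_{\bar y_i},\qquad y_i=\frac{z_i}{\sqrt{1+|z_{i+1}|^2+\cdots+|z_n|^2}},$$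 where $y_1,\dots,y_n$ are complex-valued (non-holomorphic) smooth coordinates on this cell and $\partial_{y_i},\partial_{\bar y_i}$ are the associated Wirtinger vector fields. Lenard scheme: for a Poisson pencil $\alpha\pi_0+\beta\pi_1$ and a vector field $V$ preserving the pencil, it produces a sequence of smooth functions $g_1,g_2,\dots$ such that $g_1$ is the Hamiltonian of $V$ with respect to $\pi_0$ (that is, $V=i_{dg_1}\pi_0$) and the $\pi_0$-hamiltonian vector field of $g_k$ equals the $\pi_1$-hamiltonian vector field of $g_{k+1}$, $i_{dg_k}\pi_0=i_{dg_{k+1}}\pi_1$; the functions $g_k$ are in involution with respect to both $\pi_0$ and $\pi_1$. Here $i_{dg}\pi$ denotes the contraction of the bivector field $\pi$ with $dg$, and $\pi_0=\pi_\infty$, $\pi_1=\pi_s$.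
   Formalization: The Lenard sequence is stated as g_k/k rather than g_k, because the recursion i_{dg_k}π_∞ = i_{dg_{k+1}}π_s fails literally for g_k = Σc_j^k (for n=1, k=1 it gives c_1∂_φ versus 2c_1∂_φ); complete integrability is stated for the g_k themselves. *)

(* Defs.v *)
From HB Require Import structures.
From mathcomp Require Import all_boot all_order all_algebra.
From mathcomp Require Import all_classical all_reals all_analysis.
From mathcomp Require Import complex generic_quotient ring.
Set Implicit Arguments.
Unset Strict Implicit.
Unset Printing Implicit Defensive.
Import Order.TTheory GRing.Theory Num.Theory numFieldNormedType.Exports.
Local Open Scope classical_set_scope.
Local Open Scope ring_scope.
Local Open Scope quotient_scope.

(* R^(2n) is 'rV[R]_(n + n): left block = real parts (resp. the momentum
   coordinates x), right block = imaginary parts (resp. the angles phi).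
   All indices are shifted by one: i : 'I_n stands for the index i + 1. *)

Section Calculus.
Variables (R : realType) (m : nat).
Implicit Types (F : 'rV[R]_m -> R) (w : 'rV[R]_m).

Fixpoint Ck (k : nat) F : Prop :=
  if k is k'.+1 then
    (forall w, differentiable F w) /\ (forall v, Ck k' (fun w => 'D_v F w))
  else continuous F.

Definition Cinfty F : Prop := forall k, Ck k F.

Definition partial (a : 'I_m) F w : R := 'D_(delta_mx 0 a) F w.

Definition grad F w : 'rV[R]_m := \row_a partial a F w.

End Calculus.

Section Wirtinger.
Variables (R : realType) (n : nat).
Implicit Types (F : 'rV[R]_(n + n) -> R) (w : 'rV[R]_(n + n)).

Definition wirtinger (i : 'I_n) F w : R[i] :=
  2^-1 * ((partial (lshift n i) F w)%:C%C
          - 'i%C * (partial (rshift n i) F w)%:C%C).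

Definition wirtinger_bar (i : 'I_n) F w : R[i] :=
  2^-1 * ((partial (lshift n i) F w)%:C%C
          + 'i%C * (partial (rshift n i) F w)%:C%C).

End Wirtinger.

Section ProjectiveSpace.
Variables (R : realType) (n : nat).

Definition nzrow := {Z : 'rV[R[i]]_n.+1 | Z != 0}.

(* Equality of row spaces, i.e. of the lines spanned by Z and W. *)
Definition proportional (Z W : nzrow) : bool := (val Z == val W)%MS.

Lemma proportional_refl : reflexive proportional.
Proof. by move=> Z; rewrite /proportional submx_refl. Qed.

Lemma proportional_sym : symmetric proportional.
Proof. by move=> Z W; rewrite /proportional andbC. Qed.

Lemma proportional_trans : transitive proportional.
Proof.
move=> W Z T /andP[ZW WZ] /andP[WT TW]; apply/andP; split.
  exact: submx_trans ZW WT.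
exact: submx_trans TW WZ.
Qed.

Canonical proportional_equiv :=
  EquivRel proportional proportional_refl proportional_sym proportional_trans.

Definition CP := {eq_quot proportional}.

Definition sqnorm (z : R[i]) : R := complex.Re z ^+ 2 + complex.Im z ^+ 2.

Definition cpart (w : 'rV[R]_(n + n)) (j : 'I_n) : R[i] :=
  (w 0 (lshift n j) +i* w 0 (rshift n j))%C.

Definition chart_row (k : 'I_n.+1) (w : 'rV[R]_(n + n)) : 'rV[R[i]]_n.+1 :=
  \row_i (if unlift k i is Some j then cpart w j else 1).

Lemma chart_row_neq0 k w : chart_row k w != 0.
Proof.
apply/eqP => /rowP /(_ k); rewrite !mxE unlift_none => /eqP.
by rewrite oner_eq0.
Qed.

(* The inverse of the affine chart {Z_k != 0} -> C^n = R^(2n). *)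
Definition chart (k : 'I_n.+1) (w : 'rV[R]_(n + n)) : CP :=
  \pi_CP (exist _ (chart_row k w) (chart_row_neq0 k w) : nzrow).

Definition smooth (f : CP -> R) : Prop := forall k, Cinfty (f \o chart k).

Definition cp_open (U : set CP) : Prop := forall k, open (chart k @^-1` U).

Definition cp_dense (D : set CP) : Prop :=
  forall U, cp_open U -> U !=set0 -> (U `&` D) !=set0.

End ProjectiveSpace.

Section Momentum.
Variables (R : realType) (n : nat).

(* The homogeneous form of delta_{1,i} - r_i^2 / (1 + r_1^2 + ... + r_n^2),
   which extends the momentum coordinates to all of CP^n. *)
Definition momentum_row (Z : 'rV[R[i]]_n.+1) (i : 'I_n) : R :=
  (i == 0 :> nat)%:R
  - sqnorm (Z 0 (lift ord0 i)) / \sum_k sqnorm (Z 0 k).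

Definition mom (i : 'I_n) (p : CP R n) : R := momentum_row (val (repr p)) i.

Lemma mom_pi i (Z : nzrow R n) :
  mom i (\pi_(CP R n) Z) = momentum_row (val Z) i.
Proof.
have /eqmodP/andP[/sub_rVP[a E] _] : repr (\pi_(CP R n) Z) = Z %[mod CP R n].
  by rewrite reprK.
rewrite /mom /momentum_row E.
have sqM (z : R[i]) : sqnorm (a * z) = sqnorm a * sqnorm z.
  by case: a z {E} => a1 a2 [z1 z2]; rewrite /sqnorm /=; ring.
have Em k : (a *: val Z) 0 k = a * val Z 0 k by rewrite mxE.
have a0 : sqnorm a != 0.
  apply/eqP => a0; move: (valP (repr (\pi_(CP R n) Z))); rewrite E.
  suff -> : a = 0 by rewrite scale0r eqxx.
  move/eqP: a0; case: (a) => a1 a2; rewrite /sqnorm /=.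
  by rewrite paddr_eq0 ?sqr_ge0 // !sqrf_eq0 => /andP[/eqP-> /eqP->].
rewrite !Em !sqM; under eq_bigr => k _ do rewrite Em sqM.
by rewrite -mulr_sumr -mulf_div divff // mul1r.
Qed.

Lemma mom_chart0 i w :
  mom i (chart ord0 w) =
  (i == 0 :> nat)%:R
  - sqnorm (cpart w i) / (1 + \sum_j sqnorm (cpart w j)).
Proof.
rewrite mom_pi /momentum_row /= mxE liftK big_ord_recl mxE unlift_none.
congr (_ - _ / (_ + _)); first by rewrite /sqnorm /= expr1n expr0n addr0.
by apply: eq_bigr => j _; rewrite mxE liftK.
Qed.

Definition csum (k : 'I_n) (p : CP R n) : R := \sum_(i < n | (i <= k)%N) mom i p.

(* Since i_{dc_j} pi_oo = c_j i_{dc_j} pi_s, the functions satisfying the Lenard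
   recursion i_{dh_k} pi_oo = i_{dh_(k+1)} pi_s are h_k = gpow k / k. *)
Definition gpow (k : nat) (p : CP R n) : R := \sum_j csum j p ^+ k.

(* The point z_i = r_i exp(sqrt(-1) phi_i) of the cell {Z_0 != 0}. *)
Definition polar (r phi : 'rV[R]_n) : CP R n :=
  chart ord0 (row_mx (\row_i (r 0 i * cos (phi 0 i)))
                     (\row_i (r 0 i * sin (phi 0 i)))).

Definition xphi (r phi : 'rV[R]_n) : 'rV[R]_(n + n) :=
  row_mx (\row_i mom i (polar r phi)) phi.

(* F is the expression of f in the coordinates (x, phi); F is constrained only
   on the open set of values of these coordinates. *)
Definition in_xphi (f : CP R n -> R) (F : 'rV[R]_(n + n) -> R) : Prop :=
  forall r phi : 'rV[R]_n, (forall i, 0 < r 0 i) -> f (polar r phi) = F (xphi r phi).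

(* The coordinates y on the cell {Z_0 != 0}, as functions of z. *)
Definition bruhat_scale (w : 'rV[R]_(n + n)) (i : 'I_n) : R :=
  Num.sqrt (1 + \sum_(j < n | (i < j)%N) sqnorm (cpart w j)).

Definition ycoord (w : 'rV[R]_(n + n)) : 'rV[R]_(n + n) :=
  row_mx (\row_i (w 0 (lshift n i) / bruhat_scale w i))
         (\row_i (w 0 (rshift n i) / bruhat_scale w i)).

Definition in_y (f : CP R n -> R) (F : 'rV[R]_(n + n) -> R) : Prop :=
  forall w, f (chart ord0 w) = F (ycoord w).

End Momentum.

(* Vector fields on CP^n are derivations of C^oo(CP^n) and bivector fields are
   skew-symmetric biderivations, the bivector field pi being identified with
   (f, g) |-> pi(df, dg). Their values on non-smooth arguments are irrelevant. *)
Section PoissonGeometry.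
Variables (R : realType) (n : nat).
Local Notation fct := (CP R n -> R).
Implicit Types (X Y V : fct -> fct) (br : fct -> fct -> fct).

Definition vector_field X : Prop :=
  [/\ forall f, smooth f -> smooth (X f),
      forall (a : R) f h, smooth f -> smooth h ->
        forall p, X (fun q => a * f q + h q) p = a * X f p + X h p
    & forall f h, smooth f -> smooth h ->
        forall p, X (fun q => f q * h q) p = X f p * h p + f p * X h p].

Definition vf_eq X Y : Prop := forall f, smooth f -> forall p, X f p = Y f p.

Definition bivector_field br : Prop :=
  (forall f, smooth f -> vector_field (br f)) /\
  (forall f h, smooth f -> smooth h -> forall p, br f h p = - br h f p).

Definition poisson br : Prop :=
  bivector_field br /\
  (forall f h l, smooth f -> smooth h -> smooth l ->
    forall p, br f (br h l) p + br h (br l f) p + br l (br f h) p = 0).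

Definition combination (a b : R) (pi0 pi1 : fct -> fct -> fct) :
    fct -> fct -> fct :=
  fun f h p => a * pi0 f h p + b * pi1 f h p.

Definition poisson_pencil (pi0 pi1 : fct -> fct -> fct) : Prop :=
  forall a b : R, poisson (combination a b pi0 pi1).

(* The contraction i_{df} pi, with i_{df} (X /\ Y) = X(f) Y - Y(f) X. *)
Definition contraction (f : fct) br : fct -> fct := br f.

(* The Lie derivative of the bivector field along V vanishes. *)
Definition preserves V br : Prop :=
  forall f h, smooth f -> smooth h ->
    forall p, V (br f h) p = br (V f) h p + br f (V h) p.

Definition in_involution br f h : Prop := forall p : CP R n, br f h p = 0.

(* h 1, h 2, ... is a sequence produced by the Lenard scheme for the pencil
   (pi0, pi1) starting from V and g1; the value h 0 plays no role. *)
Definition lenard_scheme (pi0 pi1 : fct -> fct -> fct) V (g1 : fct)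
    (h : nat -> fct) : Prop :=
  (forall a b : R, preserves V (combination a b pi0 pi1)) /\
  [/\ forall k, (1 <= k)%N -> smooth (h k),
      h 1%N = g1,
      vf_eq V (contraction g1 pi0),
      forall k, (1 <= k)%N ->
        vf_eq (contraction (h k) pi0) (contraction (h k.+1) pi1)
    & forall k l, (1 <= k)%N -> (1 <= l)%N ->
        in_involution pi0 (h k) (h l) /\ in_involution pi1 (h k) (h l)].

(* The differentials of G_0, ..., G_(n-1) at p are linearly independent. *)
Definition independent_at (G : 'I_n -> fct) (p : CP R n) : Prop :=
  forall k w, chart k w = p ->
    row_free (\matrix_(i < n) grad (G i \o chart k) w).

Definition hamiltonian V br : Prop :=
  exists2 H : fct, smooth H & vf_eq V (contraction H br).

(* For a Poisson pencil (pi0, pi1). The number n of first integrals G is half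
   the real dimension of CP^n. *)
Definition completely_integrable_bihamiltonian
    (pi0 pi1 : fct -> fct -> fct) V (G : 'I_n -> fct) : Prop :=
  [/\ hamiltonian V pi0 /\ hamiltonian V pi1,
      (forall i, smooth (G i)) /\ (forall i p, V (G i) p = 0),
      forall i j, in_involution pi0 (G i) (G j) /\ in_involution pi1 (G i) (G j)
    & exists D : set (CP R n),
        [/\ cp_open D, cp_dense D & forall p, D p -> independent_at G p]].

(* A two-form omega is given by its matrix omega(d_a, d_b) in a coordinate
   frame; its dual bivector field is sum_{a,b} P_ab d_a (x) d_b. The transpose
   fixes the sign: the dual of sum dx_i /\ dphi_i is sum d_{x_i} /\ d_{phi_i}. *)
Definition fubini_study_mx : 'M[R]_(n + n) := block_mx 0 1%:M (- 1%:M) 0.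

Definition dual_bivector_mx (m : nat) (W : 'M[R]_m) : 'M[R]_m := (invmx W)^T.

Lemma dual_fubini_study_mx : dual_bivector_mx fubini_study_mx = fubini_study_mx.
Proof.
have H : fubini_study_mx *m fubini_study_mx^T = 1%:M.
  rewrite /fubini_study_mx tr_block_mx mulmx_block !trmx0 !raddfN /= !trmx1.
  rewrite !(mul0mx, mulmx0, mulmx1, mulNmx, mulmxN, mul1mx, add0r, addr0).
  by rewrite opprK oppr0 -scalar_mx_block.
have U : fubini_study_mx \in unitmx by case/mulmx1_unit: H.
by rewrite /dual_bivector_mx -[invmx _]mulmx1 -H mulKmx // trmxK.
Qed.

Definition dual_to_fubini_study br : Prop :=
  forall f h, smooth f -> smooth h ->
  forall F H, in_xphi f F -> in_xphi h H ->
  forall r phi : 'rV[R]_n, (forall i, 0 < r 0 i) ->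
    br f h (polar r phi) =
      (grad F (xphi r phi) *m dual_bivector_mx fubini_study_mx
        *m (grad H (xphi r phi))^T) 0 0.

Definition bruhat br : Prop :=
  forall f h, smooth f -> smooth h ->
  forall F H, in_y f F -> in_y h H ->
  forall w, let y := ycoord w in
    (br f h (chart ord0 w))%:C%C =
      'i%C * \sum_i (1 + sqnorm (cpart y i))%:C%C
        * (wirtinger i F y * wirtinger_bar i H y
           - wirtinger_bar i F y * wirtinger i H y) :> R[i].

Definition V_coef (j : 'I_n) (p : CP R n) : R :=
  (n - j)%:R * (\sum_(i < n | (i <= j)%N) mom i p)
  + \sum_(i < n | (j < i)%N) (n - i)%:R * mom i p.

Definition V_expression V : Prop :=
  forall f, smooth f -> forall F, in_xphi f F ->
  forall r phi : 'rV[R]_n, (forall i, 0 < r 0 i) ->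
    V f (polar r phi) =
      \sum_j V_coef j (polar r phi) * partial (rshift n j) F (xphi r phi).

End PoissonGeometry.

(* Main.v *)
(* At a point z of the cell {Z_0 <> 0} let d_i be the infinitesimal rotation of
   the i-th coordinate; it is the angular field of all three coordinate systems
   z, y and (x, phi).  The dual of the Fubini-Study form gives pi_s(dc_k) =
   sum_(i <= k) d_i.  Since 1 + |y_i|^2 is a quotient of consecutive partial sums
   of 1 + |z_1|^2 + ... + |z_n|^2, telescoping gives
   c_k = prod_(i <= k) 1 / (1 + |y_i|^2), hence pi_oo(dc_k) = c_k pi_s(dc_k).
   By the Leibniz rule the functions g_k / k satisfy the Lenard recursion, and
   they are in involution because the c_k are invariant under all rotations.
   Identities between smooth functions extend from the dense set where no
   homogeneous coordinate vanishes.  There the c_k are pairwise distinct with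
   independent differentials, so a Vandermonde argument gives the independence
   of g_1, ..., g_n.  Finally V is Hamiltonian for both structures, with
   Hamiltonians g_1 and g_2 / 2, and the Jacobi identities show that it preserves
   the pencil. *)

Require Import Defs.
From HB Require Import structures.
From mathcomp Require Import all_boot all_order all_algebra.
From mathcomp Require Import all_classical all_reals all_analysis.
From mathcomp Require Import complex generic_quotient ring.
Set Implicit Arguments.
Unset Strict Implicit.
Unset Printing Implicit Defensive.
Import Order.TTheory GRing.Theory Num.Theory numFieldNormedType.Exports.
Local Open Scope classical_set_scope.
Local Open Scope ring_scope.

(** * Calculus *)

Section Smoothness.
Variables (R : realType) (m : nat).
Implicit Types (F G : 'rV[R]_m -> R) (v w : 'rV[R]_m).

(** The product rule keeps one factor undifferentiated; this lowers its order to match the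
    differentiated one in inductions on [k]. *)
Lemma Ck_pred k F : Ck k.+1 F -> Ck k F.
Proof.
elim: k F => [|k IH] F [dF CF]; last by split=> // v; apply: IH; exact: CF.
by move=> w; exact/differentiable_continuous.
Qed.

Lemma eq_Ck k F G : F =1 G -> Ck k F -> Ck k G.
Proof. by move=> /funext ->. Qed.

Lemma Ck_cst k (c : R) : @Ck R m k (fun=> c).
Proof.
elim: k c => [|k IH] c /=; first exact: cst_continuous.
split=> [w|v]; first exact: differentiable_cst.
by apply: eq_Ck (IH 0) => w; rewrite -[RHS]/('D_v (cst c) w) derive_cst.
Qed.

Lemma CkD k F G : Ck k F -> Ck k G -> Ck k (fun w => F w + G w).
Proof.
elim: k F G => [|k IH] F G /=.
  by move=> CF CG w; exact: (cvgD (CF w) (CG w)).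
move=> [dF CF] [dG CG]; split=> [w|v]; first exact: differentiableD.
apply: eq_Ck (IH _ _ (CF v) (CG v)) => w.
by rewrite -deriveD//; exact: diff_derivable.
Qed.

Lemma CkM k F G : Ck k F -> Ck k G -> Ck k (fun w => F w * G w).
Proof.
elim: k F G => [|k IH] F G.
  by move=> CF CG w; exact: (cvgM (CF w) (CG w)).
move=> CF1 CG1; have [CF0 CG0] := (Ck_pred CF1, Ck_pred CG1).
case: CF1 CG1 => dF CF [dG CG]; split=> [w|v]; first exact: differentiableM.
apply: eq_Ck (CkD (IH _ _ CF0 (CG v)) (IH _ _ CG0 (CF v))) => w.
by apply/esym/deriveM; exact: diff_derivable.
Qed.

(** The derivative of 1/F is -(1/F)^2 times that of F: a product of functions already known to be of
    class [Ck k]. *)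
Lemma CkV k F : (forall w, F w != 0) -> Ck k F -> Ck k (fun w => (F w)^-1).
Proof.
move=> F0; elim: k => [|k IH]; first by move=> CF w; exact: (cvgV (F0 w) (CF w)).
move=> CF1; have CV := IH (Ck_pred CF1); case: CF1 => dF CF.
split=> [w|v]; first exact: differentiableV.
apply: eq_Ck (CkM (CkM (Ck_cst _ (-1)) (CkM CV CV)) (CF v)) => w.
rewrite deriveV//; last exact: diff_derivable.
by rewrite /GRing.scale/= expr2 invfM mulN1r.
Qed.

Lemma Cinfty_cst (c : R) : @Cinfty R m (fun=> c).
Proof. by move=> k; exact: Ck_cst. Qed.

Lemma CinftyD F G : Cinfty F -> Cinfty G -> Cinfty (fun w => F w + G w).
Proof. by move=> CF CG k; exact: CkD. Qed.

Lemma CinftyM F G : Cinfty F -> Cinfty G -> Cinfty (fun w => F w * G w).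
Proof. by move=> CF CG k; exact: CkM. Qed.

Lemma Cinfty_sum (I : Type) (s : seq I) (P : pred I) (F : I -> 'rV[R]_m -> R) :
  (forall i, P i -> Cinfty (F i)) -> Cinfty (fun w => \sum_(i <- s | P i) F i w).
Proof.
move=> CF k; elim: s => [|i s IH].
  by apply: eq_Ck (Ck_cst k 0) => w; rewrite big_nil.
case: (boolP (P i)) => Pi.
  by apply: eq_Ck (CkD (CF i Pi k) IH) => w; rewrite big_cons Pi.
by apply: eq_Ck IH => w; rewrite big_cons (negPf Pi).
Qed.

Lemma Cinfty_prod (I : Type) (s : seq I) (P : pred I) (F : I -> 'rV[R]_m -> R) :
  (forall i, P i -> Cinfty (F i)) -> Cinfty (fun w => \prod_(i <- s | P i) F i w).
Proof.
move=> CF k; elim: s => [|i s IH].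
  by apply: eq_Ck (Ck_cst k 1) => w; rewrite big_nil.
case: (boolP (P i)) => Pi.
  by apply: eq_Ck (CkM (CF i Pi k) IH) => w; rewrite big_cons Pi.
by apply: eq_Ck IH => w; rewrite big_cons (negPf Pi).
Qed.

(** Reduces directional derivatives to one-variable ones, where [is_derive] computes. *)
Lemma derive_along F v w :
  'D_v F w = 'D_1 (fun t : R => F (w + t *: v)) 0.
Proof.
rewrite /derive; set A := (X in lim (X @ _) = _); set B := (X in _ = lim (X @ _)).
rewrite (_ : A = B)//; apply/funext => h; rewrite /A /B /=.
by rewrite addr0 scale0r addr0 /GRing.scale/= mulr1 [h *: v + w]addrC.
Qed.

Lemma derive_coord v w (a : 'I_m) :
  'D_v (fun u : 'rV[R]_m => u 0 a) w = v 0 a.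
Proof.
have /(congr1 (fun A : 'rV[R]_m => A 0 a)) := derive_mx (@derivable_id _ _ w v).
by rewrite mxE derive_id => ->.
Qed.

Lemma Cinfty_coord (a : 'I_m) : Cinfty (fun w : 'rV[R]_m => w 0 a).
Proof.
case=> [|k]; first exact: coord_continuous.
split=> [w|v]; first exact: differentiable_coord.
by apply: eq_Ck (Ck_cst k (v 0 a)) => w; rewrite derive_coord.
Qed.

Lemma Cinfty_differentiable F w : Cinfty F -> differentiable F w.
Proof. by move=> /(_ 1%N)[]. Qed.

End Smoothness.

(** * Chain rule along curves *)

Section ChainRule.
Variables (R : realType) (m : nat).

Lemma differentiable_row (V : normedModType R) (F : V -> 'rV[R]_m) (x : V) :
  (forall a, differentiable (fun y => F y 0 a) x) -> differentiable F x.
Proof.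
move=> dF.
rewrite (_ : F = \sum_(a < m) (fun y => F y 0 a *: (delta_mx 0 a : 'rV[R]_m))).
  by apply: differentiable_sum => a; exact: differentiableZl.
by apply/funext => y; rewrite fct_sumE -row_sum_delta.
Qed.

(** The velocity is required entry by entry only, so that an explicit flow can be differentiated by
    one-variable calculus. *)
Lemma derive_comp_curve (G : 'rV[R]_m -> R) (c : R -> 'rV[R]_m) (d : 'rV[R]_m)
    (t : R) :
  differentiable G (c t) ->
  (forall a, is_derive t 1 (fun s => c s 0 a) (d 0 a)) ->
  'D_1 (fun s => G (c s)) t = 'D_d G (c t).
Proof.
move=> dG dc.
have cdiff : differentiable c t.
  by apply/differentiable_row => a; apply/derivable1_diffP; case: (dc a).
have -> : d = 'D_1 c t.
  rewrite derive_mx; last exact/derivable1_diffP.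
  by apply/rowP => a; rewrite mxE; have [_ ->] := dc a.
rewrite -[LHS]/('D_1 (G \o c) t) [LHS]deriveE; last exact: differentiable_comp.
by rewrite diff_comp// [RHS]deriveE// [in RHS]deriveE.
Qed.

End ChainRule.

(** * Rotation of one complex coordinate and its generator *)

Section AngularDerivative.
Variables (R : realType) (n : nat).
Implicit Types (G : 'rV[R]_(n + n) -> R) (w : 'rV[R]_(n + n)) (i : 'I_n).

(* Multiplication of the i-th complex coordinate by exp(sqrt(-1) t). *)
Definition rotate i (t : R) w : 'rV[R]_(n + n) :=
  row_mx
    (\row_j (if j == i
             then w 0 (lshift n j) * cos t - w 0 (rshift n j) * sin t
             else w 0 (lshift n j)))
    (\row_j (if j == i
             then w 0 (lshift n j) * sin t + w 0 (rshift n j) * cos t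
             else w 0 (rshift n j))).

(** The field d/dphi_i in Cartesian coordinates, the generator of [rotate i]. *)
Definition angular i G w : R :=
  w 0 (lshift n i) * partial (rshift n i) G w
  - w 0 (rshift n i) * partial (lshift n i) G w.

Lemma rotate0 i w : rotate i 0 w = w.
Proof.
rewrite -[RHS]hsubmxK /rotate cos0 sin0; congr row_mx; apply/rowP => j.
  by rewrite !mxE mulr1 mulr0 subr0 if_same.
by rewrite !mxE mulr1 mulr0 add0r if_same.
Qed.

Lemma derive_rotate i G w : differentiable G w ->
  'D_1 (fun t => G (rotate i t w)) 0 = angular i G w.
Proof.
(* The velocity of the rotation at time 0: turning u + iv starts in the direction -v + iu. *)
move=> dG; pose d : 'rV[R]_(n + n) :=
  w 0 (lshift n i) *: delta_mx 0 (rshift n i)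
  - w 0 (rshift n i) *: delta_mx 0 (lshift n i).
have dc a : is_derive (0 : R) 1 (fun t => rotate i t w 0 a) (d 0 a).
  rewrite /d !mxE eqxx /=; case: (split_ordP a) => j ->.
    under eq_fun do rewrite row_mxEl mxE.
    rewrite eq_lrshift eq_lshift mulr0 sub0r.
    case: eqVneq => [->|_]; rewrite ?mulr1 ?mulr0 ?oppr0.
      by apply: is_derive_eq; rewrite sin0 cos0 /GRing.scale/=; ring.
    exact: is_derive_cst.
  under eq_fun do rewrite row_mxEr mxE.
  rewrite eq_rlshift eq_rshift mulr0 subr0.
  case: eqVneq => [->|_]; rewrite ?mulr1 ?mulr0 ?oppr0.
    by apply: is_derive_eq; rewrite sin0 cos0 /GRing.scale/=; ring.
  exact: is_derive_cst.
rewrite (derive_comp_curve _ dc) rotate0//.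
by rewrite /angular /partial !deriveE// linearB !linearZ.
Qed.

End AngularDerivative.

(** * Charts and density *)

Section Charts.
Variables (R : realType) (n : nat).
Implicit Types (p : CP R n) (w : 'rV[R]_(n + n)).
Local Open Scope quotient_scope.

Lemma sqnorm_ge0 (z : R[i]) : 0 <= sqnorm z.
Proof. by rewrite addr_ge0 ?sqr_ge0. Qed.

Lemma sqnorm_eq0 (z : R[i]) : (sqnorm z == 0) = (z == 0).
Proof.
case: z => a b; rewrite /sqnorm paddr_eq0 ?sqr_ge0//= !sqrf_eq0.
by rewrite eq_complex.
Qed.

Lemma sqnormM (y z : R[i]) : sqnorm (y * z) = sqnorm y * sqnorm z.
Proof. by case: y z => a b [c d]; rewrite /sqnorm /=; ring. Qed.

Lemma sqnorm1 : sqnorm (1 : R[i]) = 1.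
Proof. by rewrite /sqnorm /= expr1n expr0n addr0. Qed.

(** Unlike the momentum coordinates, these treat all n + 1 homogeneous coordinates alike. *)
Definition weight_row (Z : 'rV[R[i]]_n.+1) (l : 'I_n.+1) : R :=
  sqnorm (Z 0 l) / \sum_k sqnorm (Z 0 k).

Definition weight (l : 'I_n.+1) p : R := weight_row (val (repr p)) l.

(** The chosen representative is a nonzero multiple of [Z], and the squared modulus of the factor
    cancels in the quotient. *)
Lemma weight_pi l (Z : nzrow R n) :
  weight l (\pi_(CP R n) Z) = weight_row (val Z) l.
Proof.
have /eqmodP/andP[/sub_rVP[a E] _] : repr (\pi_(CP R n) Z) = Z %[mod CP R n].
  by rewrite reprK.
have a0 : sqnorm a != 0.
  rewrite sqnorm_eq0; apply: contraTneq (valP (repr (\pi_(CP R n) Z))) => a0.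
  by rewrite E a0 scale0r eqxx.
rewrite /weight /weight_row E mxE sqnormM.
under eq_bigr do rewrite mxE sqnormM.
by rewrite -mulr_sumr -mulf_div divff// mul1r.
Qed.

Lemma weight_row_neq0 (Z : 'rV[R[i]]_n.+1) l :
  (weight_row Z l != 0) = (Z 0 l != 0).
Proof.
apply/idP/idP => [|Zl].
  by apply: contraNneq => Z0; rewrite /weight_row Z0 /sqnorm /= expr0n addr0 mul0r.
rewrite mulf_neq0 ?sqnorm_eq0// invr_eq0 gt_eqF// (bigD1 l)//=.
rewrite ltr_wpDr ?lt_def ?sqnorm_eq0 ?Zl ?sqnorm_ge0// sumr_ge0// => k _.
exact: sqnorm_ge0.
Qed.

Lemma pi_scale (a : R[i]) (Z W : nzrow R n) :
  val Z = a *: val W -> \pi_(CP R n) Z = \pi_(CP R n) W.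
Proof.
move=> E; apply/eqmodP; rewrite /= /proportional E; apply/eqmxP/eqmx_scale.
by apply: contraTneq (valP Z) => a0; rewrite E a0 scale0r eqxx.
Qed.

Lemma chart_onto k p : weight k p != 0 -> exists w, p = chart k w.
Proof.
rewrite weight_row_neq0; set Z := repr p => Zk.
pose y j : R[i] := (val Z 0 k)^-1 * val Z 0 (lift k j).
exists (row_mx (\row_j complex.Re (y j)) (\row_j complex.Im (y j))).
rewrite -[LHS]reprK; apply/esym/(pi_scale (a := (val Z 0 k)^-1)).
apply/rowP => l; rewrite !mxE; case: unliftP => [j|] ->; last by rewrite mulVf.
by rewrite /cpart row_mxEl row_mxEr !mxE /y; case: (_ * _).
Qed.

Lemma exists_weight_neq0 p : exists k, weight k p != 0.
Proof.
have /rV0Pn[k Zk] := valP (repr p); exists k.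
by rewrite weight_row_neq0.
Qed.

Lemma sqnorm_chart_row k w j :
  sqnorm (chart_row k w 0 (lift k j)) = sqnorm (cpart w j).
Proof. by rewrite mxE liftK. Qed.

Lemma sqnorm_chart_row_diag k w : sqnorm (chart_row k w 0 k) = 1.
Proof. by rewrite mxE unlift_none sqnorm1. Qed.

Lemma weight_chart k l w :
  weight l (chart k w) =
  sqnorm (chart_row k w 0 l) / (1 + \sum_j sqnorm (cpart w j)).
Proof.
rewrite weight_pi /weight_row (bigD1_ord k)//= sqnorm_chart_row_diag.
by under eq_bigr do rewrite sqnorm_chart_row.
Qed.

Lemma modsum_gt0 w : 0 < 1 + \sum_j sqnorm (cpart w j).
Proof. by rewrite ltr_pwDl// sumr_ge0// => j _; exact: sqnorm_ge0. Qed.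

(** In the chart [k] the k-th homogeneous coordinate is 1, so only the affine ones can vanish. *)
Lemma weights_chart_neq0 k w :
  (forall l, weight l (chart k w) != 0) <-> (forall j, cpart w j != 0).
Proof.
split=> [w0 j|w0 l].
  by move: (w0 (lift k j)); rewrite weight_pi weight_row_neq0 mxE liftK.
by rewrite weight_pi weight_row_neq0 mxE; case: unliftP.
Qed.

Lemma Cinfty_sqnorm_cpart j : Cinfty (fun w => sqnorm (cpart w j)).
Proof.
have C (a : 'I_(n + n)) := @Cinfty_coord R _ a.
exact: CinftyD (CinftyM (C _) (C _)) (CinftyM (C _) (C _)).
Qed.

Lemma Cinfty_modsum : Cinfty (fun w => 1 + \sum_j sqnorm (cpart w j)).
Proof.
apply: CinftyD; first exact: Cinfty_cst.
by apply: Cinfty_sum => j _; exact: Cinfty_sqnorm_cpart.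
Qed.

Lemma Cinfty_sqnorm_chart_row k l :
  Cinfty (fun w : 'rV[R]_(n + n) => sqnorm (chart_row k w 0 l)).
Proof.
case: (unliftP k l) => [j|] -> m.
  by apply: eq_Ck (Cinfty_sqnorm_cpart j m) => w; rewrite sqnorm_chart_row.
by apply: eq_Ck (Ck_cst _ _ 1) => w; rewrite sqnorm_chart_row_diag.
Qed.

Lemma smooth_weight l : smooth (weight l).
Proof.
move=> k m; apply: (@eq_Ck _ _ _ (fun w => sqnorm (chart_row k w 0 l) *
    (1 + \sum_j sqnorm (cpart w j))^-1)) => [w|]; first by rewrite /= weight_chart.
apply: CkM; first exact: Cinfty_sqnorm_chart_row.
by apply: CkV (Cinfty_modsum m) => w; rewrite gt_eqF// modsum_gt0.
Qed.

(** Real parts suffice: along the all-ones direction a zero real part becomes t, and a nonzero one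
    survives for small t. *)
Lemma near_cpart_neq0 w :
  \forall t \near (0 : R)^', forall j, cpart (w + t *: const_mx 1) j != 0.
Proof.
apply: filter_forall => j.
have [w0|w0] := eqVneq (w 0 (lshift n j)) 0; near=> t;
  rewrite eq_complex /= !mxE mulr1 negb_and.
  by rewrite w0 add0r (_ : t != 0)//; near: t; exact: nbhs_dnbhs_neq.
rewrite (_ : _ + t != 0)// addr_eq0; apply/eqP => wt.
have : `|t| < `|w 0 (lshift n j)|.
  by near: t; apply: dnbhs0_lt; rewrite normr_gt0.
by rewrite wt normrN ltxx.
Unshelve. all: by end_near. Qed.

Lemma cvg_along_ones w :
  (w + t *: const_mx 1) @[t --> (0 : R)^'] --> w.
Proof.
suff : (w + t *: const_mx 1 : 'rV[R]_(n + n)) @[t --> (0 : R)^'] -->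
    w + 0 *: const_mx 1 by rewrite scale0r addr0.
apply: cvgD; first exact: cvg_cst.
by apply: cvgZr_tmp; apply: cvg_within_filter; exact: cvg_id.
Qed.

(** In a chart, both values at a point are limits, along the all-ones direction, of values at points
    where the functions agree. *)
Lemma smooth_dense_ext (f h : CP R n -> R) : smooth f -> smooth h ->
  (forall p, (forall l, weight l p != 0) -> f p = h p) -> forall p, f p = h p.
Proof.
move=> sf sh fh p; have [k /chart_onto[w ->]] := exists_weight_neq0 p.
have Cf : continuous (f \o chart k) := sf k 0%N.
have Ch : continuous (h \o chart k) := sh k 0%N.
have cf := cvg_comp _ _ (@cvg_along_ones w) (Cf w).
have ch := cvg_comp _ _ (@cvg_along_ones w) (Ch w).
apply: (cvg_unique (@Rhausdorff R) cf _).
apply: cvg_trans ch; apply: near_eq_cvg; near=> t.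
apply/esym/fh/weights_chart_neq0 => j; move: j; near: t; exact: near_cpart_neq0.
Unshelve. all: by end_near. Qed.

End Charts.

(** * The Fubini-Study structure *)

Section MomentumCoordinates.
Variables (R : realType) (n : nat).
Implicit Types (p : CP R n) (w u : 'rV[R]_(n + n)) (r phi : 'rV[R]_n).
Implicit Types (f : CP R n -> R).

Lemma polar_form (z : R[i]) : z != 0 ->
  exists r phi : R,
    [/\ 0 < r, complex.Re z = r * cos phi & complex.Im z = r * sin phi].
Proof.
case: z => a b; rewrite -sqnorm_eq0 /sqnorm/= => ab0.
have ab : 0 < a ^+ 2 + b ^+ 2 by rewrite lt_def ab0 addr_ge0 ?sqr_ge0.
pose r := Num.sqrt (a ^+ 2 + b ^+ 2).
have r0 : 0 < r by rewrite sqrtr_gt0.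
have r2 : r ^+ 2 = a ^+ 2 + b ^+ 2 by rewrite sqr_sqrtr// ltW.
have bd : -1 <= a / r <= 1.
  rewrite -ler_norml normrM normfV (gtr0_norm r0) ler_pdivrMr// mul1r.
  rewrite -ler_sqr ?nnegrE ?normr_ge0 ?(ltW r0)//.
  by rewrite real_normK ?num_real// r2 lerDl sqr_ge0.
have sq : Num.sqrt (1 - (a / r) ^+ 2) = `|b| / r.
  rewrite (_ : 1 - _ = (`|b| / r) ^+ 2).
    by rewrite sqrtr_sqr ger0_norm// divr_ge0// ltW.
  rewrite !expr_div_n real_normK ?num_real// r2; field.
  by rewrite gt_eqF.
have rK x : x = r * (x / r) by rewrite mulrCA divff ?gt_eqF// mulr1.
(* [acos] takes values in [0, pi], where the sine is nonnegative; a negative imaginary part needs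
   the opposite angle. *)
have [b0|b0] := lerP 0 b.
  exists r, (acos (a / r)); split=> //=; first by rewrite acosK.
  by rewrite sin_acos// sq ger0_norm.
exists r, (- acos (a / r)); split=> //=; first by rewrite cosN acosK.
by rewrite sinN sin_acos// sq ltr0_norm// mulNr opprK.
Qed.

Definition polar_row r phi : 'rV[R]_(n + n) :=
  row_mx (\row_i (r 0 i * cos (phi 0 i))) (\row_i (r 0 i * sin (phi 0 i))).

Lemma polar_onto p : (forall l, weight l p != 0) ->
  exists r phi, (forall i, 0 < r 0 i) /\ p = polar r phi.
Proof.
move=> p0; have [w pw] := chart_onto (p0 ord0).
have w0 : forall j, cpart w j != 0 by apply/(weights_chart_neq0 ord0); rewrite -pw.
have /fin_all_exists2[r r0 /fin_all_exists[phi E]] j :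
    exists2 r : R, 0 < r & exists phi : R,
      w 0 (lshift n j) = r * cos phi /\ w 0 (rshift n j) = r * sin phi.
  by have [r [phi [r0 Ec Es]]] := polar_form (w0 j); exists r => //; exists phi.
exists (\row_j r j), (\row_j phi j); split=> [i|]; first by rewrite mxE.
rewrite pw /polar; congr chart; rewrite -[LHS]hsubmxK; congr row_mx.
  by apply/rowP => j; rewrite !mxE; case: (E j).
by apply/rowP => j; rewrite !mxE; case: (E j).
Qed.

Lemma momE i p : mom i p = (i == 0 :> nat)%:R - weight (lift ord0 i) p.
Proof. by []. Qed.

Lemma cpart_row (a b : 'rV[R]_n) j : cpart (row_mx a b) j = (a 0 j +i* b 0 j)%C.
Proof. by rewrite /cpart row_mxEl row_mxEr. Qed.

Lemma sqnorm_polar r phi j : sqnorm (cpart (polar_row r phi) j) = r 0 j ^+ 2.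
Proof.
by rewrite cpart_row !mxE /sqnorm /= !exprMn -mulrDr cos2Dsin2 mulr1.
Qed.

Lemma mom_polar r phi i :
  mom i (polar r phi) =
  (i == 0 :> nat)%:R - r 0 i ^+ 2 / (1 + \sum_j r 0 j ^+ 2).
Proof.
rewrite /polar -/(polar_row r phi) mom_chart0 sqnorm_polar.
by under eq_bigr do rewrite sqnorm_polar.
Qed.

Lemma polar_rowl r phi j : polar_row r phi 0 (lshift n j) = r 0 j * cos (phi 0 j).
Proof. by rewrite row_mxEl mxE. Qed.

Lemma polar_rowr r phi j : polar_row r phi 0 (rshift n j) = r 0 j * sin (phi 0 j).
Proof. by rewrite row_mxEr mxE. Qed.

Lemma rotate_polar i t r phi :
  rotate i t (polar_row r phi) = polar_row r (phi + t *: delta_mx 0 i).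
Proof.
rewrite /rotate {5}/polar_row; congr row_mx; apply/rowP => j;
  rewrite mxE polar_rowl polar_rowr !mxE eqxx /=;
  case: eqVneq => _; rewrite ?mulr1 ?mulr0 ?addr0//.
  by rewrite cosD; ring.
by rewrite sinD; ring.
Qed.

Lemma xphil r phi j : xphi r phi 0 (lshift n j) = mom j (polar r phi).
Proof. by rewrite row_mxEl mxE. Qed.

Lemma xphir r phi j : xphi r phi 0 (rshift n j) = phi 0 j.
Proof. by rewrite row_mxEr. Qed.

Lemma xphi_shift i t r phi :
  xphi r phi + t *: delta_mx 0 (rshift n i) = xphi r (phi + t *: delta_mx 0 i).
Proof.
apply/rowP => a; rewrite mxE [X in _ + X]mxE [X in _ * X]mxE eqxx /=.
case: (split_ordP a) => j ->.
  by rewrite !xphil !mom_polar eq_lrshift mulr0 addr0.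
by rewrite !xphir !mxE eqxx eq_rshift.
Qed.

(** Moving phi_i alone in the coordinates (x, phi) is the rotation of the i-th affine coordinate, so
    the same function of t is differentiated on both sides. *)
Lemma partial_angle f F r phi i : smooth f -> in_xphi f F ->
  (forall j, 0 < r 0 j) ->
  partial (rshift n i) F (xphi r phi) =
  angular i (f \o chart ord0) (polar_row r phi).
Proof.
move=> sf fF r0; rewrite /partial derive_along -derive_rotate; last first.
  exact: Cinfty_differentiable (sf ord0).
congr (derive _ (0 : R) (1 : R)); apply/funext => t.
by rewrite xphi_shift -fF//= rotate_polar.
Qed.

(** The hypotheses on [pi_s] and [V] apply only to functions with an expression in (x, phi); this
    provides one. *)
Lemma exists_in_xphi f : exists F, in_xphi f F.
Proof.
(* [s] recovers r_i^2 / Q with Q = 1 + sum_j r_j^2. Since 1 - sum_j s_j = 1 / Q, the quotient under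
   the root is r_i^2. *)
pose s (u : 'rV[R]_(n + n)) (i : 'I_n) := (i == 0 :> nat)%:R - u 0 (lshift n i).
exists (fun u =>
  f (polar (\row_i Num.sqrt (s u i / (1 - \sum_j s u j))) (rsubmx u))).
move=> r phi r0; rewrite [in rsubmx _]/xphi row_mxKr; congr (f (polar _ _)).
set Q := 1 + \sum_j r 0 j ^+ 2.
have Q0 : 0 < Q by rewrite ltr_pwDl// sumr_ge0// => j _; exact: sqr_ge0.
have sE j : s (xphi r phi) j = r 0 j ^+ 2 / Q.
  by rewrite /s xphil mom_polar; ring.
apply/rowP => i; rewrite mxE sE.
under eq_bigr do rewrite sE.
rewrite -mulr_suml (_ : _ / _ / _ = r 0 i ^+ 2).
  by rewrite sqrtr_sqr gtr0_norm.
have -> : \sum_j r 0 j ^+ 2 = Q - 1 by rewrite /Q; ring.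
have Qn : Q != 0 by rewrite gt_eqF.
by rewrite (_ : 1 - (Q - 1) / Q = Q^-1) ?invrK ?mulfVK//; field.
Qed.

Definition csum_x (k : 'I_n) u : R := \sum_(i < n | (i <= k)%N) u 0 (lshift n i).

Lemma in_xphi_csum k : in_xphi (csum k) (csum_x k).
Proof.
move=> r phi r0; apply: eq_bigr => i _.
by rewrite xphil.
Qed.

Lemma derive_csum_x k v u : 'D_v (csum_x k) u = csum_x k v.
Proof.
rewrite derive_along.
rewrite (_ : (fun t => _) = fun t : R => csum_x k u + t * csum_x k v); last first.
  apply/funext => t; rewrite /csum_x mulr_sumr -big_split /=.
  by apply: eq_bigr => i _; rewrite !mxE.
have [_] : is_derive (0 : R) 1 (fun t : R => csum_x k u + t * csum_x k v)
    (csum_x k v).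
  by apply: is_derive_eq; rewrite /GRing.scale/=; ring.
done.
Qed.

(** c_k depends on x alone, with gradient the indicator of i <= k, and the dual matrix pairs each
    d_{x_i} with d_{phi_i}. *)
Lemma fubini_study_csum (br : (CP R n -> R) -> (CP R n -> R) -> CP R n -> R)
    k f r phi :
  dual_to_fubini_study br -> smooth (@csum R n k) -> smooth f ->
  (forall i, 0 < r 0 i) ->
  br (csum k) f (polar r phi) =
  \sum_(i < n | (i <= k)%N) angular i (f \o chart ord0) (polar_row r phi).
Proof.
move=> Hbr sc sf r0; have [F fF] := exists_in_xphi f.
rewrite (Hbr _ _ sc sf _ _ (in_xphi_csum k) fF)// dual_fubini_study_mx.
under eq_bigr do rewrite -(@partial_angle f F)//.
have gl : lsubmx (grad (csum_x k) (xphi r phi)) = \row_i (i <= k)%:R.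
  apply/rowP => i; rewrite !mxE /partial derive_csum_x /csum_x.
  case: (boolP (i <= k)%N) => ik.
    rewrite (bigD1 i)//= big1 => [|j /andP[_ ji]].
      by rewrite !mxE !eqxx addr0.
    by rewrite mxE eqxx eq_lshift (negPf ji).
  rewrite big1// => j jk; rewrite mxE eqxx eq_lshift.
  by case: eqVneq jk => // ->; rewrite (negPf ik).
have gr : rsubmx (grad (csum_x k) (xphi r phi)) = 0.
  apply/rowP => i; rewrite !mxE /partial derive_csum_x /csum_x big1// => j _.
  by rewrite !mxE eqxx eq_lrshift.
rewrite -[grad F _]hsubmxK -[grad (csum_x k) _]hsubmxK gl gr tr_row_mx.
rewrite mul_row_block mul_row_col mul0mx mulmx0 !mulmx1 mul0mx !addr0 mul0mx add0r.
rewrite mxE [RHS]big_mkcond; apply: eq_bigr => i _; rewrite !mxE.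
by case: ifP; rewrite ?mul1r ?mul0r.
Qed.

End MomentumCoordinates.

(** * The Bruhat structure *)

Section BruhatCoordinates.
Variables (R : realType) (n : nat).
Implicit Types (w y : 'rV[R]_(n + n)) (f : CP R n -> R).

(* [tail i] is the square of the scale of the i-th coordinate y (indices from 1),
   so that 1 + |y_i|^2 = tail (i - 1) / tail i. *)
Definition tail (k : nat) w : R := 1 + \sum_(j < n | (k <= j)%N) sqnorm (cpart w j).

Lemma tail_gt0 k w : 0 < tail k w.
Proof. by rewrite ltr_pwDl// sumr_ge0// => j _; exact: sqnorm_ge0. Qed.

Lemma tail_neq0 k w : tail k w != 0.
Proof. by rewrite gt_eqF// tail_gt0. Qed.

Lemma tail_full w : tail n w = 1.
Proof. by rewrite /tail big1 ?addr0// => j; rewrite leqNgt ltn_ord. Qed.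

Lemma tailS (j : 'I_n) w : tail j w = sqnorm (cpart w j) + tail j.+1 w.
Proof.
rewrite /tail (bigD1 j)//= addrCA; congr (_ + (_ + _)).
by apply: eq_bigl => i; rewrite ltn_neqAle eq_sym andbC.
Qed.

Lemma bruhat_scaleE w i : bruhat_scale w i = Num.sqrt (tail i.+1 w).
Proof. by []. Qed.

Lemma ycoordl w j : ycoord w 0 (lshift n j) = w 0 (lshift n j) / bruhat_scale w j.
Proof. by rewrite row_mxEl mxE. Qed.

Lemma ycoordr w j : ycoord w 0 (rshift n j) = w 0 (rshift n j) / bruhat_scale w j.
Proof. by rewrite row_mxEr mxE. Qed.

Lemma one_sqnorm_ycoord w j :
  1 + sqnorm (cpart (ycoord w) j) = tail j w / tail j.+1 w.
Proof.
rewrite /sqnorm /= ycoordl ycoordr bruhat_scaleE !expr_div_n sqr_sqrtr; last first.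
  by rewrite ltW// tail_gt0.
by rewrite tailS /sqnorm /=; field; exact: tail_neq0.
Qed.

(** By [one_sqnorm_ycoord] each factor is a quotient of consecutive tails, so the product
    telescopes. *)
Lemma prod_one_sqnorm_ycoord a b w : (a <= b <= n)%N ->
  \prod_(j < n | (a <= j < b)%N) (1 + sqnorm (cpart (ycoord w) j)) =
  tail a w / tail b w.
Proof.
elim: b => [|b IH] /andP[ab bn].
  by move: ab; rewrite leqn0 => /eqP ->; rewrite big_pred0 ?divff ?tail_neq0.
(* For a = b + 1 the range is empty; otherwise the factor of index b splits off. *)
have [/eqP ->|neq] := boolP (a == b.+1).
  rewrite big_pred0 ?divff ?tail_neq0// => j.
  by rewrite ltnS; case: leqP => //=; rewrite ltnNge => /negPf.
have {}ab : (a <= b)%N by move: ab; rewrite leq_eqVlt (negPf neq).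
rewrite (bigD1 (Ordinal bn)) /=; last by rewrite ab ltnSn.
rewrite one_sqnorm_ycoord /= (eq_bigl (fun j : 'I_n => a <= j < b)%N) => [|j].
  by rewrite IH ?ab 1?ltnW//; field; rewrite !tail_neq0.
by rewrite -val_eqE /= -andbA [RHS]andbC ltnS [(j < b)%N]ltn_neqAle andbC
  [(_ <= b)%N && _]andbC -andbA andbC.
Qed.

(** The shift by 1 in the first momentum coordinate enters every c_k exactly once; the subtracted
    squared moduli leave the tail beyond k. *)
Lemma csum_chart0 (k : 'I_n) w : csum k (chart ord0 w) = tail k.+1 w / tail 0 w.
Proof.
have t0 := tail_neq0 0 w.
have -> : csum k (chart ord0 w) =
    1 - (\sum_(i < n | (i <= k)%N) sqnorm (cpart w i)) / tail 0 w.
  rewrite /csum; under eq_bigr do rewrite mom_chart0.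
  rewrite sumrB -mulr_suml; congr (_ - _).
  rewrite (bigD1 (Ordinal (leq_ltn_trans (leq0n k) (ltn_ord k))))//= big1 ?addr0//.
  by move=> i /andP[_]; rewrite -val_eqE /= => /negPf ->.
rewrite -[1](divff t0) -mulrBl; congr (_ / _).
rewrite /tail (bigID (fun i : 'I_n => (i <= k)%N))/=.
rewrite [X in _ + (_ + X)](eq_bigl (fun i : 'I_n => (k < i)%N)).
  by ring.
by move=> i; rewrite -ltnNge.
Qed.

(** [bruhat_scale] recovered from y: its square is the telescoped product over j > i. *)
Definition yscale_inv y (i : 'I_n) : R :=
  Num.sqrt (\prod_(j < n | (i < j)%N) (1 + sqnorm (cpart y j))).

Definition zcoord y : 'rV[R]_(n + n) :=
  row_mx (\row_i (y 0 (lshift n i) * yscale_inv y i))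
         (\row_i (y 0 (rshift n i) * yscale_inv y i)).

Lemma zcoordl y j : zcoord y 0 (lshift n j) = y 0 (lshift n j) * yscale_inv y j.
Proof. by rewrite row_mxEl mxE. Qed.

Lemma zcoordr y j : zcoord y 0 (rshift n j) = y 0 (rshift n j) * yscale_inv y j.
Proof. by rewrite row_mxEr mxE. Qed.

Lemma one_sqnorm_gt0 y (j : 'I_n) : 0 < 1 + sqnorm (cpart y j).
Proof. by rewrite ltr_pwDl ?sqnorm_ge0. Qed.

(** The telescoping product up to n, where the tail is 1, returns the scale by which each z_i was
    divided. *)
Lemma ycoordK : cancel (@ycoord R n) zcoord.
Proof.
move=> w; have E j : yscale_inv (ycoord w) j = bruhat_scale w j.
  rewrite bruhat_scaleE /yscale_inv.
  have -> : tail j.+1 w = tail j.+1 w / tail n w by rewrite tail_full divr1.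
  rewrite -prod_one_sqnorm_ycoord ?ltn_ord ?leqnn//.
  by congr Num.sqrt; apply: eq_bigl => i; rewrite ltn_ord andbT.
have b0 j : bruhat_scale w j != 0.
  by rewrite bruhat_scaleE gt_eqF// sqrtr_gt0 tail_gt0.
apply/rowP => a; case: (split_ordP a) => j ->.
  by rewrite zcoordl ycoordl E mulfVK.
by rewrite zcoordr ycoordr E mulfVK.
Qed.

(** The products under the square roots are positive, where the root is differentiable. *)
Lemma differentiable_zcoord y : differentiable zcoord y.
Proof.
pose P (i : 'I_n) y := \prod_(j < n | (i < j)%N) (1 + sqnorm (cpart y j)).
have dS i : differentiable (yscale_inv^~ i) y.
  apply: (@differentiable_comp _ _ _ _ (P i) Num.sqrt).
    apply: Cinfty_differentiable; apply: Cinfty_prod => j _.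
    by apply: CinftyD; [exact: Cinfty_cst|exact: Cinfty_sqnorm_cpart].
  apply/derivable1_diffP.
  have P0 : 0 < P i y by apply: prodr_gt0 => j _; exact: one_sqnorm_gt0.
  by have [] := is_derive1_sqrt P0.
apply: differentiable_row => a; case: (split_ordP a) => j ->.
  rewrite (_ : (fun y => _) = fun y => y 0 (lshift n j) * yscale_inv y j).
    by apply: differentiableM => //; exact: differentiable_coord.
  by apply/funext => u; rewrite zcoordl.
rewrite (_ : (fun y => _) = fun y => y 0 (rshift n j) * yscale_inv y j).
  by apply: differentiableM => //; exact: differentiable_coord.
by apply/funext => u; rewrite zcoordr.
Qed.

Lemma rotatel i t w j : rotate i t w 0 (lshift n j) =
  if j == i then w 0 (lshift n j) * cos t - w 0 (rshift n j) * sin t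
  else w 0 (lshift n j).
Proof. by rewrite row_mxEl mxE. Qed.

Lemma rotater i t w j : rotate i t w 0 (rshift n j) =
  if j == i then w 0 (lshift n j) * sin t + w 0 (rshift n j) * cos t
  else w 0 (rshift n j).
Proof. by rewrite row_mxEr mxE. Qed.

Lemma sqnorm_rotate i t w j : sqnorm (cpart (rotate i t w) j) = sqnorm (cpart w j).
Proof.
rewrite /sqnorm /= rotatel rotater; case: ifP => // _.
by rewrite -[RHS]mul1r -(cos2Dsin2 t); ring.
Qed.

Lemma zcoord_rotate i t y : zcoord (rotate i t y) = rotate i t (zcoord y).
Proof.
have E j : yscale_inv (rotate i t y) j = yscale_inv y j.
  by congr Num.sqrt; apply: eq_bigr => l _; rewrite sqnorm_rotate.
apply/rowP => a; case: (split_ordP a) => j ->.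
  by rewrite zcoordl !rotatel zcoordl zcoordr E; case: ifP => // _; ring.
by rewrite zcoordr !rotater zcoordl zcoordr E; case: ifP => // _; ring.
Qed.

(** Scales depend on moduli only, so rotations commute with [zcoord] and their generators
    correspond. *)
Lemma angular_zcoord i (G : 'rV[R]_(n + n) -> R) w : differentiable G w ->
  angular i (G \o zcoord) (ycoord w) = angular i G w.
Proof.
move=> dG; rewrite -!derive_rotate//; last first.
  apply: differentiable_comp; first exact: differentiable_zcoord.
  by rewrite ycoordK.
congr (derive _ (0 : R) (1 : R)); apply/funext => t /=.
by rewrite zcoord_rotate ycoordK.
Qed.

Definition csum_y (k : 'I_n) y : R :=
  \prod_(i < n | (i <= k)%N) (1 + sqnorm (cpart y i))^-1.

Lemma in_y_csum k : in_y (csum k) (csum_y k).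
Proof.
move=> w; rewrite csum_chart0 /csum_y.
have := @prod_one_sqnorm_ycoord 0 k.+1 w (ltn_ord k).
move=> /(congr1 (fun x => x^-1)); rewrite invf_div => <-.
by rewrite prodfV.
Qed.

(** Only the i-th factor varies along [v], so the derivative is [csum_y k y] times the logarithmic
    derivative of that factor. *)
Lemma derive_csum_y k (i : 'I_n) (v y : 'rV[R]_(n + n)) :
  (forall j, j != i -> v 0 (lshift n j) = 0 /\ v 0 (rshift n j) = 0) ->
  'D_v (csum_y k) y =
  if (i <= k)%N then
    - (2 * (y 0 (lshift n i) * v 0 (lshift n i)
            + y 0 (rshift n i) * v 0 (rshift n i))
       / (1 + sqnorm (cpart y i)) * csum_y k y)
  else 0.
Proof.
move=> v0; rewrite derive_along.
have E j t : j != i -> sqnorm (cpart (y + t *: v) j) = sqnorm (cpart y j).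
  by move=> /v0[vl vr]; rewrite /sqnorm /= !mxE vl vr mulr0 !addr0.
case: ifPn => ik; last first.
  rewrite (_ : (fun t => _) = cst (csum_y k y)) ?derive_cst//.
  apply/funext => t; apply: eq_bigr => j jk; rewrite E//.
  by apply: contraNneq ik => <-.
pose K := \prod_(j < n | (j <= k)%N && (j != i)) (1 + sqnorm (cpart y j))^-1.
have yK : csum_y k y = (1 + sqnorm (cpart y i))^-1 * K by rewrite /csum_y (bigD1 i).
pose q (t : R) := 1 + ((y 0 (lshift n i) + t * v 0 (lshift n i)) ^+ 2 +
                 (y 0 (rshift n i) + t * v 0 (rshift n i)) ^+ 2).
have q0 : q 0 = 1 + sqnorm (cpart y i) by rewrite /q !mul0r !addr0.
rewrite (_ : (fun t => _) = fun t : R => (q t)^-1 * K); last first.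
  apply/funext => t; rewrite /csum_y (bigD1 i)//=; congr (_ * _).
    by rewrite /sqnorm /= !mxE.
  by apply: eq_bigr => j /andP[_ ji]; rewrite E.
have qn0 : q 0 != 0 by rewrite q0 gt_eqF// one_sqnorm_gt0.
set D := y 0 (lshift n i) * v 0 (lshift n i) + y 0 (rshift n i) * v 0 (rshift n i).
have dq : is_derive (0 : R) 1 q (2 * D).
  by apply: is_derive_eq; rewrite /GRing.scale/= /D; ring.
have dqV := is_deriveV qn0 dq.
have [_ ->] : is_derive (0 : R) 1 (fun t : R => (q t)^-1 * K)
    (K * (- q 0 ^- 2 * (2 * D))).
  by apply: is_derive_eq; rewrite /GRing.scale/=; ring.
by rewrite yK -q0; field.
Qed.

(** The real form of the Bruhat summand: for y = a + ib, sqrt(-1) d_y /\ d_ybar is -1/2 d_a /\ d_b.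
    Here p, q and s, t are the partial derivatives of the two arguments in a and b. *)
Lemma wirtinger_wedge (m p q s t : R) :
  'i%C * (m%:C%C
    * ((2^-1 * (p%:C%C - 'i%C * q%:C%C)) * (2^-1 * (s%:C%C + 'i%C * t%:C%C))
       - (2^-1 * (p%:C%C + 'i%C * q%:C%C)) * (2^-1 * (s%:C%C - 'i%C * t%:C%C))))
  = (m * (q * s - p * t) / 2)%:C%C :> R[i].
Proof.
have ii : 'i%C * 'i%C = -1 :> R[i] by rewrite -expr2 sqr_i.
transitivity
    (('i%C * 'i%C) * (m%:C%C * (p%:C%C * t%:C%C - q%:C%C * s%:C%C)) / 2 : R[i]).
  by field.
by rewrite ii rmorphM fmorphV rmorph_nat !rmorphM rmorphB !rmorphM; field.
Qed.

(** Differentiating c_k produces a factor 2 / (1 + |y_i|^2), which cancels the coefficient of the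
    bivector and the 1/2 of its real form; the angular fields in y are then carried to z. *)
Lemma bruhat_csum (br : (CP R n -> R) -> (CP R n -> R) -> CP R n -> R) k f w :
  bruhat br -> smooth (@csum R n k) -> smooth f ->
  br (csum k) f (chart ord0 w) =
  csum k (chart ord0 w) * \sum_(i < n | (i <= k)%N) angular i (f \o chart ord0) w.
Proof.
move=> Hbr sc sf; set y := ycoord w; pose H := (f \o chart ord0) \o zcoord.
have fH : in_y f H by move=> u; rewrite /H /= ycoordK.
apply: complexI; rewrite (Hbr _ _ sc sf _ _ (in_y_csum k) fH) -/y.
rewrite in_y_csum -/y [in RHS]big_mkcond !mulr_sumr rmorph_sum /=.
apply: eq_bigr => i _; rewrite /wirtinger /wirtinger_bar wirtinger_wedge.
congr (_%:C%C); rewrite -(angular_zcoord i (G := f \o chart ord0)); last first.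
  exact: Cinfty_differentiable (sf ord0).
rewrite -/H -/y /angular.
have -> : partial (lshift n i) (csum_y k) y = if (i <= k)%N then
    - (2 * y 0 (lshift n i) / (1 + sqnorm (cpart y i)) * csum_y k y) else 0.
  rewrite /partial (@derive_csum_y k i) => [|j ji].
    by rewrite !mxE !eqxx eq_rlshift mulr1 mulr0 addr0.
  by rewrite !mxE !eqxx eq_rlshift eq_lshift (negPf ji).
have -> : partial (rshift n i) (csum_y k) y = if (i <= k)%N then
    - (2 * y 0 (rshift n i) / (1 + sqnorm (cpart y i)) * csum_y k y) else 0.
  rewrite /partial (@derive_csum_y k i) => [|j ji].
    by rewrite !mxE !eqxx eq_lrshift mulr1 mulr0 add0r.
  by rewrite !mxE !eqxx eq_lrshift eq_rshift (negPf ji).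
have := one_sqnorm_gt0 y i; move: (1 + _) (csum_y k y) => m c m0.
move: (partial (lshift n i) H y) (partial (rshift n i) H y) => s t.
move: (y 0 (lshift n i)) (y 0 (rshift n i)) => yl yr.
case: ifP => _; first by field; rewrite gt_eqF.
by rewrite !mul0r subrr !mulr0 mul0r.
Qed.

End BruhatCoordinates.

(** * Derivations and independence *)

Section SmoothFunctions.
Variables (R : realType) (n : nat).
Implicit Types (f h : CP R n -> R) (p : CP R n).

Lemma smooth_cst (c : R) : smooth (fun _ : CP R n => c).
Proof. by move=> k; exact: Cinfty_cst. Qed.

Lemma smoothD f h : smooth f -> smooth h -> smooth (fun p => f p + h p).
Proof. by move=> sf sh k; exact: (CinftyD (sf k) (sh k)). Qed.

Lemma smoothM f h : smooth f -> smooth h -> smooth (fun p => f p * h p).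
Proof. by move=> sf sh k; exact: (CinftyM (sf k) (sh k)). Qed.

Lemma smoothX f m : smooth f -> smooth (fun p => f p ^+ m).
Proof.
move=> sf; elim: m => [|m IH]; first exact: smooth_cst.
by under eq_fun do rewrite exprS; exact: smoothM.
Qed.

Lemma smooth_sum (I : Type) (s : seq I) (P : pred I) (F : I -> CP R n -> R) :
  (forall i, smooth (F i)) -> smooth (fun p => \sum_(i <- s | P i) F i p).
Proof.
move=> sF k; apply: (@Cinfty_sum _ _ _ _ _ (fun i => F i \o chart k)) => i _.
exact: sF.
Qed.

Lemma smooth_mom i : smooth (@mom R n i).
Proof.
rewrite (_ : mom i = fun p => (i == 0 :> nat)%:R + -1 * weight (lift ord0 i) p).
  by apply: smoothD (smooth_cst _) (smoothM (smooth_cst _) (@smooth_weight R n _)).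
by apply/funext => p; rewrite momE mulN1r.
Qed.

Lemma smooth_csum k : smooth (@csum R n k).
Proof. exact: smooth_sum smooth_mom. Qed.

Lemma smooth_gpow m : smooth (@gpow R n m).
Proof. by apply: smooth_sum => j; exact: smoothX (smooth_csum j). Qed.

End SmoothFunctions.

(** * Derivations at a point and their values on c_k and its power sums *)

Section Derivations.
Variables (R : realType) (n : nat).
Implicit Types (f h : CP R n -> R) (p : CP R n).

(** Stated at one point to cover both a vector field evaluated at [p] and a directional derivative
    in a chart. *)
Definition derivation_at p (d : (CP R n -> R) -> R) : Prop :=
  (forall (a : R) f h, smooth f -> smooth h ->
     d (fun q => a * f q + h q) = a * d f + d h) /\
  (forall f h, smooth f -> smooth h ->
     d (fun q => f q * h q) = d f * h p + f p * d h).

Lemma vector_field_derivation (X : (CP R n -> R) -> CP R n -> R) p :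
  vector_field X -> derivation_at p (fun f => X f p).
Proof. by case=> _ XL XM; split=> *; [exact: XL|exact: XM]. Qed.

Variables (p : CP R n) (d : (CP R n -> R) -> R).
Hypothesis dp : derivation_at p d.

(** The Leibniz rule for 1 = 1 * 1 forces d(1) = 0; linearity gives the other constants. *)
Lemma derivation_cst (c : R) : d (fun=> c) = 0.
Proof.
have [dL dM] := dp.
have s1 := @smooth_cst R n 1; have s0 := @smooth_cst R n 0.
have d0 : d (fun=> 0) = 0.
  have := dL 1 _ _ s0 s0; rewrite mulr0 addr0 => E.
  by apply: (addIr (d (fun=> 0))); rewrite add0r {3}E mul1r.
have d1 : d (fun=> 1) = 0.
  have := dM _ _ s1 s1; rewrite !mulr1 mul1r => E.
  by apply: (addIr (d (fun=> 1))); rewrite add0r -E.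
by have := dL c _ _ s1 s0; rewrite mulr1 addr0 d1 d0 mulr0 addr0.
Qed.

Lemma derivationZ (c : R) f : smooth f -> d (fun q => c * f q) = c * d f.
Proof.
move=> sf; have := dp.1 c _ _ sf (@smooth_cst R n 0).
by rewrite derivation_cst addr0 => <-; congr d; apply/funext => q; rewrite addr0.
Qed.

Lemma derivationD f h : smooth f -> smooth h -> d (fun q => f q + h q) = d f + d h.
Proof.
move=> sf sh; rewrite -[in RHS](mul1r (d f)) -dp.1//.
by congr d; apply/funext => q; rewrite mul1r.
Qed.

Lemma derivation_sum (I : Type) (s : seq I) (P : pred I) (F : I -> CP R n -> R) :
  (forall i, smooth (F i)) ->
  d (fun q => \sum_(i <- s | P i) F i q) = \sum_(i <- s | P i) d (F i).
Proof.
move=> sF; elim: s => [|i s IH].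
  rewrite big_nil -[RHS](derivation_cst 0).
  by congr d; apply/funext => q; rewrite big_nil.
rewrite big_cons -IH; case: ifP => Pi.
  rewrite -derivationD//; last exact: smooth_sum.
  by congr d; apply/funext => q; rewrite big_cons Pi.
by congr d; apply/funext => q; rewrite big_cons Pi.
Qed.

Lemma derivationX f m : smooth f ->
  d (fun q => f q ^+ m) = m%:R * (f p ^+ m.-1 * d f).
Proof.
move=> sf; elim: m => [|m IH]; first by rewrite mul0r derivation_cst.
rewrite (_ : (fun q => f q ^+ m.+1) = fun q => f q * f q ^+ m); last first.
  by apply/funext => q; rewrite exprS.
rewrite dp.2//; last exact: smoothX.
rewrite IH; case: m {IH} => [|m] /=; first by rewrite mul0r expr0; ring.
by rewrite exprS -[in RHS]natr1; ring.
Qed.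

Lemma derivation_gpow m :
  d (gpow m) = m%:R * \sum_j csum j p ^+ m.-1 * d (csum j).
Proof.
rewrite /gpow derivation_sum; last by move=> j; exact: smoothX (@smooth_csum R n j).
rewrite mulr_sumr; apply: eq_bigr => j _.
exact: derivationX (@smooth_csum R n j).
Qed.

Lemma derivation_csum k :
  d (csum k) = - \sum_(i < n | (i <= k)%N) d (weight (lift ord0 i)).
Proof.
rewrite /csum derivation_sum; last exact: smooth_mom.
rewrite -sumrN; apply: eq_bigr => i _.
have -> : d (mom i) = d (fun q => -1 * weight (lift ord0 i) q + (i == 0 :> nat)%:R).
  by congr d; apply/funext => q; rewrite momE; ring.
rewrite dp.1 ?derivation_cst ?mulN1r ?addr0//; last exact: smooth_cst.
exact: smooth_weight.
Qed.

End Derivations.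

(** * Linear independence of the differentials of the power sums *)

Section Independence.
Variables (R : realType) (n : nat).
Implicit Types (p : CP R n) (w : 'rV[R]_(n + n)).

Lemma derivation_chart k w v :
  derivation_at (chart k w) (fun f : CP R n -> R => 'D_v (f \o chart k) w).
Proof.
have D f : smooth f -> derivable (f \o chart k) w v.
  by move=> sf; apply: diff_derivable; exact: Cinfty_differentiable (sf k).
split=> [a f h /D Df /D Dh|f h /D Df /D Dh].
  by have := deriveD (derivableZ (k := a) Df) Dh; rewrite (deriveZ a Df) => <-.
have := deriveM Df Dh; rewrite /GRing.scale/= addrC [h _ * _]mulrC => <-.
by [].
Qed.

(** The Euler field r_l d/dr_l: a step [t] along it multiplies the l-th affine coordinate by 1 +
    t. *)
Definition radial (l : 'I_n) w : 'rV[R]_(n + n) :=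
  w 0 (lshift n l) *: delta_mx 0 (lshift n l)
  + w 0 (rshift n l) *: delta_mx 0 (rshift n l).

Lemma sqnorm_radial l w (t : R) j :
  sqnorm (cpart (w + t *: radial l w) j) =
  (if j == l then (1 + t) ^+ 2 else 1) * sqnorm (cpart w j).
Proof.
rewrite /sqnorm /= !mxE !eqxx !eq_lshift !eq_rshift !eq_lrshift !eq_rlshift /=.
by case: eqVneq => [->|_]; rewrite ?mulr1 ?mulr0 ?add0r ?addr0; ring.
Qed.

Lemma derive_weight_radial k l w i :
  'D_(radial l w) (weight i \o chart k) w =
  2 * weight (lift k l) (chart k w) *
  ((i == lift k l)%:R - weight i (chart k w)).
Proof.
rewrite derive_along; pose z := sqnorm (cpart w l).
pose Q := 1 + \sum_j sqnorm (cpart w j).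
have Q0 : Q != 0 by rewrite gt_eqF// modsum_gt0.
(* [e] records whether the numerator moves; the increment 2t + t^2 in [q] and [r] is (1 + t)^2 -
   1. *)
pose e : R := (i == lift k l)%:R.
pose s := sqnorm (chart_row k w 0 i).
pose q (t : R) := s * (1 + e * (2 * t + t ^+ 2)).
pose r (t : R) := Q + (2 * t + t ^+ 2) * z.
have -> : (fun t : R => (weight i \o chart k) (w + t *: radial l w)) =
    fun t => q t * (r t)^-1.
  apply/funext => t; rewrite /= weight_chart; congr (_ / _).
    rewrite /q /s /e; case: (unliftP k i) => [j|] ->.
      rewrite !sqnorm_chart_row sqnorm_radial (inj_eq (@lift_inj _ _)).
      by case: eqVneq => _ /=; ring.
    by rewrite !sqnorm_chart_row_diag (negPf (neq_lift _ _)) /=; ring.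
  under eq_bigr do rewrite sqnorm_radial.
  rewrite (bigD1 l)//= eqxx /r /Q [in RHS](bigD1 l)//= -/z.
  under eq_bigr => j jl do rewrite (negPf jl) mul1r.
  by ring.
have r0 : r 0 != 0 by rewrite /r mulr0 expr0n addr0 mul0r addr0.
have dq : is_derive (0 : R) 1 q (2 * s * e).
  by apply: is_derive_eq; rewrite /GRing.scale/=; ring.
have dr : is_derive (0 : R) 1 r (2 * z).
  by apply: is_derive_eq; rewrite /GRing.scale/=; ring.
have drV := is_deriveV r0 dr.
have [_ ->] := is_deriveM dq drV.
rewrite !weight_chart sqnorm_chart_row -/z -/Q -/s -/e.
have -> : r 0 = Q by rewrite /r; ring.
have -> : q 0 = s by rewrite /q; ring.
have se : s * e = z * e.
  rewrite /s /e; case: eqVneq => [->|_]; last by rewrite !mulr0.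
  by rewrite sqnorm_chart_row.
rewrite /GRing.scale/= (_ : 2 * s * e = 2 * (z * e)); last by rewrite -se; ring.
by field.
Qed.

Lemma sum_weight p : \sum_l weight l p = 1.
Proof.
have [k /chart_onto[w ->]] := exists_weight_neq0 p.
under eq_bigr do rewrite weight_chart.
rewrite -mulr_suml (bigD1_ord k)//= sqnorm_chart_row_diag.
under eq_bigr do rewrite sqnorm_chart_row.
by rewrite divff// gt_eqF// modsum_gt0.
Qed.

(* The n + 1 weights sum to 1, and this is the only linear relation between
   their differentials where no weight vanishes. *)
Lemma weight_independent k w (a : 'I_n.+1 -> R) :
  (forall l, weight l (chart k w) != 0) ->
  (forall v, \sum_i a i * 'D_v (weight i \o chart k) w = 0) ->
  forall i j, a i = a j.
Proof.
move=> s0 aD; pose s i := weight i (chart k w).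
have {}s0 i : s i != 0 := s0 i.
(* [A] is the weighted mean of the coefficients. Along [radial l] the relation reads 2 s_l (a_l - A)
   = 0. *)
pose A := \sum_i a i * s i.
have aL l : a (lift k l) = A.
  have := aD (radial l w); under eq_bigr do rewrite derive_weight_radial.
  rewrite (eq_bigr (fun i => 2 * s (lift k l) *
    (a i * (i == lift k l)%:R - a i * s i))) => [|i _]; last first.
    by rewrite -/(s i) -/(s (lift k l)); ring.
  rewrite -mulr_sumr sumrB -/A (bigD1 (lift k l))//= eqxx mulr1 big1 => [|i il].
    have c0 : 2 * s (lift k l) != 0 by rewrite mulf_neq0 ?pnatr_eq0.
    by move=> /eqP; rewrite mulf_eq0 (negPf c0) /= addr0 subr_eq0 => /eqP.
  by rewrite (negPf il) mulr0.
suff aA i : a i = A by move=> i j; rewrite !aA.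
case: (unliftP k i) => [l|] ->; first exact: aL.
(* The index [k] has no radial field in its own chart; the weighted deviations from the mean sum to
   0 and all others vanish. *)
have : \sum_i s i * (a i - A) = 0.
  rewrite (eq_bigr (fun i => a i * s i - s i * A)) => [|j _]; last by ring.
  by rewrite sumrB -mulr_suml sum_weight mul1r subrr.
rewrite (bigD1_ord k)//= big1 => [|l _]; last by rewrite aL subrr mulr0.
by move/eqP; rewrite addr0 mulf_eq0 (negPf (s0 _)) /= subr_eq0 => /eqP.
Qed.

Lemma tail_decreasing (a b : nat) w : (a < b <= n)%N -> (forall j, cpart w j != 0) ->
  tail b w < tail a w.
Proof.
move=> + w0; elim: b => [|b IH] /andP[ab bn]; first by rewrite ltn0 in ab.
have step : tail b.+1 w < tail b w.
  rewrite -[b]/(val (Ordinal bn)) [ltRHS]tailS ltrDr lt_def sqnorm_eq0 w0.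
  exact: sqnorm_ge0.
move: ab; rewrite ltnS leq_eqVlt => /orP[/eqP ->//|ab].
by apply: lt_trans step (IH _); rewrite ab ltnW.
Qed.

(** Each c_k is a tail over a common total, and nonzero coordinates make the tails strictly
    decrease. These values are the Vandermonde nodes. *)
Lemma csum_injective p : (forall l, weight l p != 0) ->
  injective (fun k : 'I_n => csum k p).
Proof.
move=> p0; have [w pw] := chart_onto (p0 ord0).
have w0 : forall j, cpart w j != 0 by apply/(weights_chart_neq0 ord0); rewrite -pw.
have lt (i j : 'I_n) : (i < j)%N -> csum j p < csum i p.
  move=> ij; rewrite pw !csum_chart0 ltr_pM2r ?invr_gt0 ?tail_gt0//.
  by apply: tail_decreasing => //; rewrite ltnS ij ltn_ord.
move=> i j /= E; apply/val_inj; case: (ltngtP i j) => // /lt; rewrite E ltxx//.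
Qed.

(** Each entry is the difference of consecutive upper sums, the sum after the last index being
    empty. *)
Lemma upper_sums_eq0 (x : 'I_n -> R) :
  (forall i : 'I_n, \sum_(j < n | (i <= j)%N) x j = 0) -> forall i, x i = 0.
Proof.
move=> x0 i; have := x0 i; rewrite (bigD1 i)//=.
rewrite (eq_bigl (fun j : 'I_n => i < j)%N) => [|j]; last first.
  by rewrite ltn_neqAle eq_sym andbC.
have [ni|ni] := ltnP i.+1 n; first by rewrite (x0 (Ordinal ni)) addr0.
rewrite big_pred0 ?addr0// => j; apply/negbTE; rewrite -leqNgt.
by rewrite -ltnS (leq_trans (ltn_ord j)).
Qed.

Lemma gpow_independent p : (forall l, weight l p != 0) ->
  independent_at (fun i : 'I_n => gpow i.+1) p.
Proof.
move=> p0 k w pw; apply: inj_row_free => u uM.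
(* The row relation [u *m M = 0], tested against an arbitrary direction [v]. *)
have uD v : \sum_i u 0 i * 'D_v (gpow i.+1 \o chart k) w = 0.
  have dG i : differentiable (@gpow R n i \o chart k) w.
    exact: Cinfty_differentiable (@smooth_gpow R n i k).
  transitivity
      (\sum_a v 0 a * (u *m \matrix_(i < n) grad (gpow i.+1 \o chart k) w) 0 a).
    under [RHS]eq_bigr do rewrite mxE mulr_sumr.
    rewrite exchange_big; apply: eq_bigr => i _ /=.
    rewrite deriveE// [in LHS](row_sum_delta v) linear_sum mulr_sumr /=.
    apply: eq_bigr => a _; rewrite linearZ /= -deriveE// !mxE /partial.
    by rewrite /GRing.scale/=; ring.
  by rewrite uM big1// => a _; rewrite mxE mulr0.
(* Since d(c_j^(i+1)) = (i+1) c_j^i dc_j, the relation becomes sum_j q(c_j) dc_j = 0 for this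
   [q]. *)
pose q := rVpoly (\row_i (u 0 i * i.+1%:R)).
have qE x : q.[x] = \sum_i u 0 i * i.+1%:R * x ^+ i.
  rewrite (horner_coef_wide _ (size_poly _ _)).
  by apply: eq_bigr => i _; rewrite coef_rVpoly_ord mxE.
have bD v : \sum_(i < n) (\sum_(j < n | (i <= j)%N) q.[csum j p]) *
    'D_v (weight (lift ord0 i) \o chart k) w = 0.
  have dv := derivation_chart k w v; rewrite pw in dv.
  apply/eqP; rewrite -oppr_eq0 -[X in _ == X](uD v); apply/eqP.
  under [RHS]eq_bigr do rewrite (derivation_gpow dv) mulr_sumr mulr_sumr.
  rewrite [RHS]exchange_big /=.
  transitivity (\sum_j q.[csum j p] * 'D_v (csum j \o chart k) w); last first.
    apply: eq_bigr => j _; rewrite qE mulr_suml; apply: eq_bigr => i _.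
    by rewrite -!mulrA.
  under [RHS]eq_bigr do rewrite (derivation_csum dv) mulrN mulr_sumr.
  rewrite sumrN (exchange_big_dep xpredT)//=; congr (- _); apply: eq_bigr => i _.
  by rewrite mulr_suml.
(* In terms of the weights, the one of index 0 is absent from every c_j. Its coefficient 0 is the
   common value of all coefficients. *)
pose a (l : 'I_n.+1) : R :=
  if unlift ord0 l is Some i then \sum_(j < n | (i <= j)%N) q.[csum j p] else 0.
have q0 j : q.[csum j p] = 0.
  move: j; apply: upper_sums_eq0 => i.
  have : a (lift ord0 i) = a ord0.
    apply: (@weight_independent k w); first by rewrite pw.
    move=> v; rewrite big_ord_recl {1}/a unlift_none mul0r add0r -[RHS](bD v).
    by apply: eq_bigr => j _; rewrite /a liftK.
  by rewrite /a liftK unlift_none.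
(* The n distinct values c_j are roots of a polynomial of degree less than n. *)
have : q = 0.
  apply: (@roots_geq_poly_eq0 _ _ [seq csum j p | j <- enum 'I_n]).
  - by apply/allP => _ /mapP[j _ ->]; exact/eqP.
  - by rewrite map_inj_uniq ?enum_uniq//; exact: csum_injective.
  - by rewrite size_map size_enum_ord size_poly.
move=> /(congr1 (fun r : {poly R} => poly_rV r : 'rV_n)).
rewrite /q rVpolyK linear0 => /rowP u0.
apply/rowP => i; have := u0 i; rewrite !mxE => /eqP.
by rewrite mulf_eq0 pnatr_eq0 orbF => /eqP.
Qed.

End Independence.

(** * The Lenard recursion *)

Section Brackets.
Variables (R : realType) (n : nat).
Local Notation fct := (CP R n -> R).
Implicit Types (f h : fct) (p : CP R n) (br : fct -> fct -> fct).

(** The open orbit of the complex torus, where the coordinates (x, phi) are available. *)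
Definition regular : set (CP R n) := [set p | forall l, weight l p != 0].

Lemma cp_open_regular : cp_open regular.
Proof.
move=> k; rewrite openE => w wU.
have nw l : \forall u \near w, weight l (chart k u) != 0.
  have C : continuous (weight l \o chart k) := @smooth_weight R n l k 0%N.
  by apply: (cvgr_neq0 _ (C w)); exact: wU.
exact: filter_forall nw.
Qed.

Lemma cp_dense_regular : cp_dense regular.
Proof.
move=> U oU [p]; have [k /chart_onto[w ->]] := exists_weight_neq0 p => Uw.
have nU : \forall t \near (0 : R)^', U (chart k (w + t *: const_mx 1)).
  have N : nbhs w (chart k @^-1` U).
    by apply: open_nbhs_nbhs; split=> //; exact: oU.
  exact: (@cvg_along_ones R n w _ N).
have [t [Ut w0]] := filter_ex (filterI nU (near_cpart_neq0 w)).
by exists (chart k (w + t *: const_mx 1)); split=> //; exact/weights_chart_neq0.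
Qed.

Lemma bracket_skew br f h : bivector_field br -> smooth f -> smooth h ->
  br f h = fun p => - br h f p.
Proof. by case=> _ sk sf sh; apply/funext => p; exact: sk. Qed.

Lemma derivation_bracket br f p : bivector_field br -> smooth f ->
  derivation_at p (fun h => br f h p).
Proof. by case=> vf _ sf; exact: vector_field_derivation (vf _ sf). Qed.

Lemma smooth_bracket br f h : bivector_field br -> smooth f -> smooth h ->
  smooth (br f h).
Proof. by case=> vf _ sf; case: (vf _ sf) => sbr _ _; exact: sbr. Qed.

(** The derivation rules act on the second argument; skew-symmetry moves the power sum there and
    back. *)
Lemma bracket_gpow br f k p : bivector_field br -> smooth f ->
  br (gpow k) f p = k%:R * \sum_j csum j p ^+ k.-1 * br (csum j) f p.
Proof.
move=> Hbr sf; rewrite (bracket_skew Hbr (@smooth_gpow R n k) sf).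
rewrite (derivation_gpow (derivation_bracket p Hbr sf)) -mulrN -sumrN.
congr (_ * _); apply: eq_bigr => j _.
by rewrite (bracket_skew Hbr sf (@smooth_csum R n j)) mulrN opprK.
Qed.

Lemma bracketZl br f h (c : R) p : bivector_field br -> smooth f -> smooth h ->
  br (fun q => c * f q) h p = c * br f h p.
Proof.
move=> Hbr sf sh; have scf : smooth (fun q => c * f q).
  exact: smoothM (@smooth_cst R n c) sf.
rewrite (bracket_skew Hbr scf sh) (derivationZ (derivation_bracket p Hbr sh) _ sf).
by rewrite (bracket_skew Hbr sf sh) mulrN.
Qed.

Lemma bracketZr br f h (c : R) p : bivector_field br -> smooth f -> smooth h ->
  br f (fun q => c * h q) p = c * br f h p.
Proof.
move=> Hbr sf sh; exact: (derivationZ (derivation_bracket p Hbr sf) c sh).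
Qed.

Lemma gpow_involution br : bivector_field br ->
  (forall i j, in_involution br (csum i) (csum j)) ->
  forall k l, in_involution br (gpow k) (gpow l).
Proof.
move=> Hbr inv k l p; rewrite (bracket_gpow _ _ Hbr (@smooth_gpow R n l)).
rewrite big1 ?mulr0// => j _.
rewrite (derivation_gpow (derivation_bracket p Hbr (@smooth_csum R n j))).
by rewrite big1 ?mulr0// => i _; rewrite inv mulr0.
Qed.

(** The Jacobi identity, solved for {g, {f, h}}, says that {g, .} is a derivation of the bracket. *)
Lemma hamiltonian_preserves br (X : fct -> fct) g : poisson br -> smooth g ->
  vf_eq X (br g) -> preserves X br.
Proof.
move=> [Hbr jac] sg Xg f h sf sh p.
have XE u : smooth u -> X u = br g u by move=> su; apply/funext; exact: Xg.
have sB u v : smooth u -> smooth v -> smooth (br u v) := @smooth_bracket br u v Hbr.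
rewrite !XE//; last exact: sB.
have sN u v : smooth u -> smooth v -> br u v = fun q => -1 * br v u q.
  by move=> su sv; apply/funext => q; rewrite mulN1r (bracket_skew Hbr su sv).
have := jac g f h sg sf sh p.
rewrite (sN h g)// (derivationZ (derivation_bracket p Hbr sf) _ (sB _ _ sg sh)).
rewrite (bracket_skew Hbr sh (sB _ _ sg sf)) mulN1r => /eqP.
by rewrite -addrA -opprD subr_eq0 addrC => /eqP ->; rewrite addrC.
Qed.

Lemma angular_csum i k w : angular i (@csum R n k \o chart ord0) w = 0.
Proof.
rewrite -derive_rotate; last first.
  exact: Cinfty_differentiable (@smooth_csum R n k ord0).
rewrite (_ : (fun t => _) = cst (csum k (chart ord0 w))) ?derive_cst//.
apply/funext => t /=; rewrite !csum_chart0 /tail.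
by congr ((_ + _) / (_ + _)); apply: eq_bigr => j _; rewrite sqnorm_rotate.
Qed.

(** x_i occurs in c_k exactly for k >= i, hence n - max(i, j) times among the k >= j. *)
Lemma V_coef_csum j p : V_coef j p = \sum_(k < n | (j <= k)%N) csum k p.
Proof.
have count (m : nat) (x : R) : \sum_(k < n | (m <= k)%N) x = (n - m)%:R * x.
  by rewrite -(big_geq_mkord m n xpredT (fun=> x)) sumr_const_nat mulr_natl.
rewrite [RHS](exchange_big_dep xpredT)//= [RHS](bigID (fun i : 'I_n => i <= j)%N)/=.
congr (_ + _).
  rewrite mulr_sumr; apply: eq_bigr => i ij; rewrite -count; apply: eq_bigl => k.
  by apply/idP/andP => [jk|[]//]; split=> //; exact: leq_trans jk.
rewrite (eq_bigl (fun i : 'I_n => j < i)%N) => [|i]; last by rewrite -ltnNge.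
apply: eq_bigr => i ji; rewrite -count; apply: eq_bigl => k.
by apply/idP/andP => [ik|[]//]; split=> //; exact: leq_trans (ltnW ji) ik.
Qed.

End Brackets.

(** * The two structures compared on c_k, and the Hamiltonian of V *)

Section LenardRecursion.
Variables (R : realType) (n : nat).
Local Notation fct := (CP R n -> R).
Variables (pi_s pi_inf : fct -> fct -> fct).
Hypotheses (Hs : dual_to_fubini_study pi_s) (Hinf : bruhat pi_inf).
Hypotheses (Bs : bivector_field pi_s) (Binf : bivector_field pi_inf).

(** On the regular locus both brackets are explicit in the same angular fields; density does the
    rest. *)
Lemma pi_inf_csum k (f : fct) : smooth f ->
  forall p, pi_inf (csum k) f p = csum k p * pi_s (csum k) f p.
Proof.
move=> sf; have sc := @smooth_csum R n k; apply: smooth_dense_ext.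
- exact: smooth_bracket.
- by apply: smoothM => //; exact: smooth_bracket.
move=> p /polar_onto[r [phi [r0 ->]]]; rewrite (fubini_study_csum _ Hs)//.
exact: bruhat_csum.
Qed.

Lemma csum_involution_s i j : in_involution pi_s (csum i) (csum j).
Proof.
have sc := @smooth_csum R n; apply: smooth_dense_ext.
- exact: smooth_bracket.
- exact: smooth_cst.
move=> p /polar_onto[r [phi [r0 ->]]]; rewrite (fubini_study_csum _ Hs)//.
by rewrite big1// => l _; exact: angular_csum.
Qed.

Lemma csum_involution_inf i j : in_involution pi_inf (csum i) (csum j).
Proof.
move=> p; rewrite pi_inf_csum; last exact: smooth_csum.
by rewrite csum_involution_s mulr0.
Qed.

(** Dividing a power sum by its exponent leaves brackets of c_j weighted by one power less, and
    passing from [pi_inf] to [pi_s] restores one factor c_j. *)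
Lemma lenard_recursion k (f : fct) p : smooth f ->
  pi_inf (fun q => k.+1%:R^-1 * gpow k.+1 q) f p =
  pi_s (fun q => k.+2%:R^-1 * gpow k.+2 q) f p.
Proof.
move=> sf; rewrite !bracketZl ?bracket_gpow//; try exact: smooth_gpow.
rewrite !mulrA !mulVf ?pnatr_eq0// !mul1r; apply: eq_bigr => j _ /=.
by rewrite pi_inf_csum// mulrA -exprSr.
Qed.

(** The coefficient of d_j is the sum of the c_k with k >= j. Exchanging sums groups V into c_k
    sum_(j <= k) d_j, the [pi_inf] field of c_k. *)
Lemma V_hamiltonian V (f : fct) p : vector_field V -> V_expression V -> smooth f ->
  V f p = pi_inf (fun q => \sum_j csum j q) f p.
Proof.
move=> HV HVx sf; move: p; have sc := @smooth_csum R n.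
have sg : smooth (fun q : CP R n => \sum_j csum j q) by exact: smooth_sum.
apply: smooth_dense_ext; [by case: HV => sV _ _; exact: sV|exact: smooth_bracket|].
move=> p /polar_onto[r [phi [r0 ->]]].
have [F fF] := exists_in_xphi f.
rewrite (HVx _ sf _ fF)//; under eq_bigr do
  rewrite (partial_angle _ _ sf fF)// V_coef_csum mulr_suml.
rewrite (exchange_big_dep xpredT)//= (bracket_skew Binf sg sf).
rewrite (derivation_sum (derivation_bracket _ Binf sf))// -sumrN.
apply: eq_bigr => k _; rewrite (bracket_skew Binf sf (sc k)) opprK.
by rewrite (bruhat_csum _ Hinf)// mulr_sumr.
Qed.

End LenardRecursion.

Theorem proposition5p1 (R : realType) (n : nat)
    (pi_s pi_inf : (CP R n -> R) -> (CP R n -> R) -> (CP R n -> R))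
    (V : (CP R n -> R) -> (CP R n -> R))
    (Hs : dual_to_fubini_study pi_s)
    (Hinf : bruhat pi_inf)
    (Hpencil : poisson_pencil pi_inf pi_s)
    (HV : vector_field V)
    (HVx : V_expression V) :
  lenard_scheme pi_inf pi_s V
    (fun p : CP R n => \sum_(j < n) csum j p)
    (fun (k : nat) (p : CP R n) => k%:R^-1 * gpow k p)
  /\ completely_integrable_bihamiltonian pi_inf pi_s V
       (fun (i : 'I_n) (p : CP R n) => gpow i.+1 p).
Proof.
(* The two structures are the members (1, 0) and (0, 1) of the pencil. *)
have Pinf : poisson pi_inf.
  rewrite (_ : pi_inf = combination 1 0 pi_inf pi_s)//.
  by do 3 apply/funext => ?; rewrite /combination mul1r mul0r addr0.
have Ps : poisson pi_s.
  rewrite (_ : pi_s = combination 0 1 pi_inf pi_s)//.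
  by do 3 apply/funext => ?; rewrite /combination mul1r mul0r add0r.
have [[Binf _] [Bs _]] := (Pinf, Ps).
pose h k (p : CP R n) : R := k%:R^-1 * gpow k p.
have sh k : smooth (h k) := smoothM (@smooth_cst R n _) (@smooth_gpow R n k).
have h1 : h 1 = fun p => \sum_j csum j p.
  by apply/funext => p; rewrite /h invr1 mul1r.
have Vinf : vf_eq V (pi_inf (h 1)).
  by move=> f sf p; rewrite h1; exact: V_hamiltonian.
(* The first instance of the recursion trades g_1 for g_2 / 2. *)
have Vs : vf_eq V (pi_s (h 2)).
  by move=> f sf p; rewrite Vinf//; exact: lenard_recursion.
have Is := gpow_involution Bs (csum_involution_s Hs Bs).
have Iinf := gpow_involution Binf (csum_involution_inf Hs Hinf Bs Binf).
split; split.
(* The Lie derivative is linear in the bivector field, so preserving both structures is enough. *)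
- move=> a b f g sf sg p; have sB := smooth_bracket.
  rewrite /combination; have dV := vector_field_derivation p HV.
  rewrite dV.1 ?(derivationZ dV)//; try exact: sB.
    rewrite (hamiltonian_preserves Pinf (sh 1) Vinf sf sg).
    by rewrite (hamiltonian_preserves Ps (sh 2) Vs sf sg); ring.
  by apply: smoothM; [exact: smooth_cst|exact: sB].
- split; [by move=> k _; exact: sh|exact: h1| | |].
  + by rewrite /contraction -h1.
  + by move=> [//|k] _ f sf p; exact: lenard_recursion.
  move=> k l _ _; have sG := @smooth_gpow R n.
  by split=> p; rewrite bracketZl ?bracketZr// ?Iinf ?Is ?mulr0//; exact: (sh l).
- by split; [exists (h 1)|exists (h 2)].
- split=> [i|i p]; first exact: smooth_gpow.
  (* V differentiates along the flow of g_1, which is in involution with every power sum. *)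
  rewrite Vinf; last exact: smooth_gpow.
  rewrite bracketZl//; try exact: smooth_gpow.
  by rewrite Iinf mulr0.
- by move=> i j; split; [exact: Iinf|exact: Is].
- exists (@regular R n); split; [exact: cp_open_regular|exact: cp_dense_regular|].
  exact: gpow_independent.
Qed.
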